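(* Let $\mathcal A=\{h_1,\dots,h_8\}$ be the arrangement in $\mathbb R^3$ of the planes spanned by the eight faces of a regular octahedron, labelled as in the context, and let $V_q$ be its $59\times59$ $q$-Varchenko matrix, with the regions ordered as in the context. Then the Smith normal form of $V_q$ over $\mathbb Z[q]$ is $$\mathrm{diag}\big(1,\ (1-q^2)I_8,\ (1-q^2)^2I_{24},\ (1-q^2)^3I_{20},\ (1-q^2)^2(1-q^8)I_6\big),$$ with left transition matrix $LU$ and right transition matrix $U^tR$, i.e. $(LU)V_q(U^tR)$ equals this diagonal matrix, where $U,L,R$ are as follows. With block sizes $1,6,2,6,6,6,6,6,6,6,2,6$, $U$ is $$\left(\begin{array}{cccccccccccc} 1&0&0&0&0&0&0&0&0&0&0&0\\ -q\mathbf 1&I_6&0&0&0&0&0&0&0&0&0&0\\ -q\mathbf 1&0&I_2&0&0&0&0&0&0&0&0&0\\ q^2\mathbf 1&-q(I+J^5)&0&I_6&0&0&0&0&0&0&0&0\\ q^2\mathbf 1&-qI&-q\mathbf I_2^t&0&I_6&0&0&0&0&0&0&0\\ 0&q^2I&0&-qI&-qI&I_6&0&0&0&0&0&0\\ 0&0&q^2\mathbf I_2^t&0&-q(I+J^4)&0&I_6&0&0&0&0&0\\ 0&-q^4I+q^2J^4&0&q^3I-qJ^5&q^3I-qJ^4&-q^2I&0&I_6&0&0&0&0\\ 0&q^2J^5&-q^4\mathbf I_2^t&-q(I+J^5)&q^3(I+J^4)&0&-q^2I&0&I_6&0&0&0\\ 0&-q^3I&0&q^2(I+J)&q^2I&-qI&0&-qJ^2&-qJ&I_6&0&0\\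 0&0&-q^3I_2&0&q^2\mathbf I_2&0&-q\mathbf I_2&0&0&0&I_2&0\\ -q^4\mathbf 1&q^3(J^4+J^5)&0&-q^2J^5&q^2I&-qI&-qI&0&0&0&0&I_6 \end{array}\right),$$ and with block sizes $33,6,6,6,2,6$, $$L=\begin{pmatrix}I_{33}&0&0&0&0&0\\0&I_6&q^2I_6&0&0&-qI_6\\0&0&I_6&0&0&0\\0&0&0&I_6&0&0\\0&0&0&0&I_2&0\\0&-qI_6&q^5I_6&0&0&(1+q^2)I_6\end{pmatrix},\quad R=\begin{pmatrix}I_{33}&0&0&0&0&0\\0&I_6&-q^4I_6&0&0&q^5I_6\\0&0&I_6&0&0&-qI_6\\0&0&0&I_6&0&0\\0&0&0&0&I_2&0\\0&0&-qI_6&0&0&(1+q^2)I_6\end{pmatrix}.$$ Here $\mathbf 1$ denotes a column of ones of the appropriate length, $I=I_6$, $\mathbf I_2$ is the $2\times6$ matrix formed by three copies of $I_2$ side by side, and $J$ is the $6\times6$ permutation matrix with $J_{r,r+1}=1$ for $1\le r\le5$, $J_{6,1}=1$ and all other entries $0$.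
   Context: For a hyperplane arrangement, the regions are the connected components of the complement of the union of the hyperplanes; $sep(R,R')$ is the set of hyperplanes separating $R$ from $R'$. The $q$-Varchenko matrix $V_q$ is indexed by the regions, with $(R,R')$-entry $q^{\#sep(R,R')}$. Labelling of the planes: in coordinates in which the octahedron is $|x|+|y|+|z|\le1$, $h_k$ is the plane $\epsilon_1x+\epsilon_2y+\epsilon_3z=1$ with sign vector $(\epsilon_1,\epsilon_2,\epsilon_3)$ equal to: $h_1:(+,+,+)$, $h_2:(-,+,+)$, $h_3:(-,-,+)$, $h_4:(-,-,-)$, $h_5:(+,-,-)$, $h_6:(+,+,-)$, $h_7:(+,-,+)$, $h_8:(-,+,-)$. $R_0$ is the interior of the octahedron. A region $R$ is denoted by the string of indices of the planes in $sep(R_0,R)$ (with $0$ denoting $R_0$). The 59 regions, in order, are: $0$; $1,2,3,4,5,6$; $7,8$; $16,12,23,34,45,56$; $17,28,37,48,57,68$; $167,128,237,348,457,568$; $157,268,137,248,357,468$; $567,168,127,238,347,458$; $156,126,123,234,345,456$; $1267,1238,2347,3458,4567,1568$; $1357,2468$; $1567,1268,1237,2348,3457,4568$. A Smith normal form over $\mathbb Z[q]$ of an $m\times m$ matrix $M$ over $\mathbb Z[q]$ is a diagonal matrix $D=\mathrm{diag}(d_1,\dots,d_m)$ with $d_k\mid d_{k+1}$ in $\mathbb Z[q]$ for all $k$ and $D=AMB$ with $A,B\in GL_m(\mathbb Z[q])$; $A$ and $B$ are the left and right transition matrices. *)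

(* Defs.v *)
From mathcomp Require Import all_boot all_order all_algebra.
From mathcomp Require Import all_classical all_reals all_analysis.

Set Implicit Arguments.
Unset Strict Implicit.
Unset Printing Implicit Defensive.

Import Order.TTheory GRing.Theory Num.Theory numFieldNormedType.Exports.

Local Open Scope classical_set_scope.
Local Open Scope ring_scope.

(* An arrangement is a family of pairs (a, b), where (a, b) stands for the     *)
(* affine hyperplane of equation \sum_j a_j x_j = b.                           *)
Section Arrangement.
Variables (R : realType) (n : nat) (I : finType) (A : I -> 'rV[R]_n * R).

Definition lin_form (a x : 'rV[R]_n) : R := \sum_j a 0 j * x 0 j.

Definition hyperplane (h : 'rV[R]_n * R) : set 'rV[R]_n :=
  [set x | lin_form h.1 x = h.2].

Definition above (h : 'rV[R]_n * R) : set 'rV[R]_n :=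
  [set x | h.2 < lin_form h.1 x].

Definition below (h : 'rV[R]_n * R) : set 'rV[R]_n :=
  [set x | lin_form h.1 x < h.2].

Definition arr_complement : set 'rV[R]_n :=
  ~` \bigcup_k hyperplane (A k).

Definition regions : set (set 'rV[R]_n) :=
  [set connected_component arr_complement x | x in arr_complement].

Definition separates (h : 'rV[R]_n * R) (C C' : set 'rV[R]_n) : Prop :=
  (C `<=` below h /\ C' `<=` above h) \/ (C `<=` above h /\ C' `<=` below h).

Definition sep (C C' : set 'rV[R]_n) : {set I} :=
  [set k | `[< separates (A k) C C' >]].

Definition varchenko_mx (m : nat) (reg : 'I_m -> set 'rV[R]_n) :
    'M[{poly int}]_m :=
  \matrix_(i, j) 'X^#|sep (reg i) (reg j)|.

End Arrangement.

(* The library's divisibility on {poly int} is pseudo-divisibility (it ignores *)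
(* nonzero constant factors), hence the explicit ring divisibility.            *)
Definition ring_dvd (S : comUnitRingType) (a b : S) : Prop :=
  exists c : S, b = c * a.

(* D is a Smith normal form of M, with left and right transition matrices P, Q *)
Definition smith_normal_form (S : comUnitRingType) (m : nat)
    (M D P Q : 'M[S]_m) : Prop :=
  [/\ is_diag_mx D,
      forall i j : 'I_m, j = i.+1 :> nat -> ring_dvd (D i i) (D j j),
      P \in unitmx, Q \in unitmx & D = P *m M *m Q].

(* The planes h_1, ..., h_8 are indexed by 0, ..., 7 : 'I_8. *)
Definition octa_signs : seq (seq int) :=
  [:: [:: 1; 1; 1]; [:: -1; 1; 1]; [:: -1; -1; 1]; [:: -1; -1; -1];
      [:: 1; -1; -1]; [:: 1; 1; -1]; [:: 1; -1; 1]; [:: -1; 1; -1]].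

Definition octa_planes (R : realType) (k : 'I_8) : 'rV[R]_3 * R :=
  (\row_j ((nth [::] octa_signs k)`_j)%:~R, 1).

Definition octahedron (R : realType) : set 'rV[R]_3 :=
  [set x | \sum_j `|x 0 j| <= 1].

Definition octa_center (R : realType) : set 'rV[R]_3 := (@octahedron R)°.

(* Indices are those of h_1, ..., h_8; the empty string stands for R_0. *)
Definition octa_labels : seq (seq nat) :=
  [::
    [::];
    [:: 1]; [:: 2]; [:: 3]; [:: 4]; [:: 5]; [:: 6];
    [:: 7]; [:: 8];
    [:: 1; 6]; [:: 1; 2]; [:: 2; 3]; [:: 3; 4]; [:: 4; 5]; [:: 5; 6];
    [:: 1; 7]; [:: 2; 8]; [:: 3; 7]; [:: 4; 8]; [:: 5; 7]; [:: 6; 8];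
    [:: 1; 6; 7]; [:: 1; 2; 8]; [:: 2; 3; 7]; [:: 3; 4; 8]; [:: 4; 5; 7];
    [:: 5; 6; 8];
    [:: 1; 5; 7]; [:: 2; 6; 8]; [:: 1; 3; 7]; [:: 2; 4; 8]; [:: 3; 5; 7];
    [:: 4; 6; 8];
    [:: 5; 6; 7]; [:: 1; 6; 8]; [:: 1; 2; 7]; [:: 2; 3; 8]; [:: 3; 4; 7];
    [:: 4; 5; 8];
    [:: 1; 5; 6]; [:: 1; 2; 6]; [:: 1; 2; 3]; [:: 2; 3; 4]; [:: 3; 4; 5];
    [:: 4; 5; 6];
    [:: 1; 2; 6; 7]; [:: 1; 2; 3; 8]; [:: 2; 3; 4; 7]; [:: 3; 4; 5; 8];
    [:: 4; 5; 6; 7]; [:: 1; 5; 6; 8];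
    [:: 1; 3; 5; 7]; [:: 2; 4; 6; 8];
    [:: 1; 5; 6; 7]; [:: 1; 2; 6; 8]; [:: 1; 2; 3; 7]; [:: 2; 3; 4; 8];
    [:: 3; 4; 5; 7]; [:: 4; 5; 6; 8]]%N.

(* reg lists all the regions, without repetition, in the order of the labels. *)
Definition octa_ordering (R : realType) (reg : 'I_59 -> set 'rV[R]_3) : Prop :=
  set_bij setT (regions (@octa_planes R)) reg /\
  forall i : 'I_59, sep (@octa_planes R) (@octa_center R) (reg i) =
    [set k : 'I_8 | k.+1 \in nth [::] octa_labels i]%SET.

Notation "[ 'rowb' a , .. , b & c ]" := (row_mx a .. (row_mx b c) ..)
  (at level 0, a at level 99, b at level 99, c at level 99).
Notation "[ 'colb' a , .. , b & c ]" := (col_mx a .. (col_mx b c) ..)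
  (at level 0, a at level 99, b at level 99, c at level 99).

Section OctaMatrices.
Local Notation q := ('X : {poly int}).
Local Notation I := (1%:M : 'M[{poly int}]_6).
Local Notation I2 := (1%:M : 'M[{poly int}]_2).
Local Notation one := (const_mx 1).
Local Notation bU := (1 + (6 + (2 + (6 + (6 + (6 + (6 + (6 + (6 + (6 + (2 +
  6)))))))))))%N.
Local Notation bLR := (33 + (6 + (6 + (6 + (2 + 6)))))%N.

Definition octa_J : 'M[{poly int}]_6 :=
  \matrix_(i, j) ((j : nat) == (i.+1 %% 6)%N)%:R.
Local Notation J := octa_J.

Definition octa_I2 : 'M[{poly int}]_(2, 6) := [rowb I2, I2 & I2].
Local Notation K := octa_I2.

(* The sums of block sizes are convertible to 59. *)
Definition octa_U : 'M[{poly int}]_59 :=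
  ([colb
  [rowb 1%:M, 0, 0, 0, 0, 0, 0, 0, 0, 0, 0 & 0],
  [rowb - q *: one, I, 0, 0, 0, 0, 0, 0, 0, 0, 0 & 0],
  [rowb - q *: one, 0, I2, 0, 0, 0, 0, 0, 0, 0, 0 & 0],
  [rowb q ^+ 2 *: one, - q *: (I + J ^+ 5), 0, I, 0, 0, 0, 0, 0, 0, 0 & 0],
  [rowb q ^+ 2 *: one, - q *: I, - q *: K^T, 0, I, 0, 0, 0, 0, 0, 0 & 0],
  [rowb 0, q ^+ 2 *: I, 0, - q *: I, - q *: I, I, 0, 0, 0, 0, 0 & 0],
  [rowb 0, 0, q ^+ 2 *: K^T, 0, - q *: (I + J ^+ 4), 0, I, 0, 0, 0, 0 & 0],
  [rowb 0, - q ^+ 4 *: I + q ^+ 2 *: J ^+ 4, 0, q ^+ 3 *: I - q *: J ^+ 5,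
        q ^+ 3 *: I - q *: J ^+ 4, - q ^+ 2 *: I, 0, I, 0, 0, 0 & 0],
  [rowb 0, q ^+ 2 *: J ^+ 5, - q ^+ 4 *: K^T, - q *: (I + J ^+ 5),
        q ^+ 3 *: (I + J ^+ 4), 0, - q ^+ 2 *: I, 0, I, 0, 0 & 0],
  [rowb 0, - q ^+ 3 *: I, 0, q ^+ 2 *: (I + J), q ^+ 2 *: I, - q *: I, 0,
        - q *: J ^+ 2, - q *: J, I, 0 & 0],
  [rowb 0, 0, - q ^+ 3 *: I2, 0, q ^+ 2 *: K, 0, - q *: K, 0, 0, 0, I2 & 0] &
  [rowb - q ^+ 4 *: one, q ^+ 3 *: (J ^+ 4 + J ^+ 5), 0, - q ^+ 2 *: J ^+ 5,
        q ^+ 2 *: I, - q *: I, - q *: I, 0, 0, 0, 0 & I]]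
  : 'M[{poly int}]_(bU, bU)).

Definition octa_L : 'M[{poly int}]_59 :=
  ([colb
  [rowb 1%:M, 0, 0, 0, 0 & 0],
  [rowb 0, I, q ^+ 2 *: I, 0, 0 & - q *: I],
  [rowb 0, 0, I, 0, 0 & 0],
  [rowb 0, 0, 0, I, 0 & 0],
  [rowb 0, 0, 0, 0, I2 & 0] &
  [rowb 0, - q *: I, q ^+ 5 *: I, 0, 0 & (1 + q ^+ 2) *: I]]
  : 'M[{poly int}]_(bLR, bLR)).

Definition octa_R : 'M[{poly int}]_59 :=
  ([colb
  [rowb 1%:M, 0, 0, 0, 0 & 0],
  [rowb 0, I, - q ^+ 4 *: I, 0, 0 & q ^+ 5 *: I],
  [rowb 0, 0, I, 0, 0 & - q *: I],
  [rowb 0, 0, 0, I, 0 & 0],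
  [rowb 0, 0, 0, 0, I2 & 0] &
  [rowb 0, 0, - q *: I, 0, 0 & (1 + q ^+ 2) *: I]]
  : 'M[{poly int}]_(bLR, bLR)).

Definition octa_D : 'M[{poly int}]_59 :=
  diag_mx ([rowb const_mx 1,
                 const_mx (1 - q ^+ 2),
                 const_mx ((1 - q ^+ 2) ^+ 2),
                 const_mx ((1 - q ^+ 2) ^+ 3) &
                 const_mx ((1 - q ^+ 2) ^+ 2 * (1 - q ^+ 8))]
           : 'rV[{poly int}]_(1 + (8 + (24 + (20 + 6))))).

End OctaMatrices.

(* Main.v *)
(** The regions of an arrangement are its nonempty sign cells: a cell is convex,
    and a connected set avoiding all the hyperplanes stays in one cell. For the
    octahedron, rational points show that the 59 listed sign vectors occur, and
    the other 197 are excluded by affine dependencies among the eight face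
    equations. Hence the Varchenko matrix is the explicit matrix of q^d, with d
    the size of the symmetric difference of two labels, and the factorization is
    a finite computation with integer polynomials coded as coefficient lists. *)
Require Import Defs.
From mathcomp Require Import all_boot all_order all_algebra.
From mathcomp Require Import all_classical all_reals all_analysis.
From mathcomp Require Import ring lra.

Set Implicit Arguments.
Unset Strict Implicit.
Unset Printing Implicit Defensive.

Import Order.TTheory GRing.Theory Num.Theory numFieldNormedType.Exports.

Local Open Scope classical_set_scope.
Local Open Scope ring_scope.

(** * Reflection of matrices of integer polynomials *)

(* Coefficients in increasing degree. The operations of [int] are called directly
   so that they compute without unfolding the ring structure. *)
Fixpoint padd (s t : seq int) : seq int :=
  match s, t with
  | [::], _ => t
  | _, [::] => s
  | a :: s', b :: t' => intZmod.addz a b :: padd s' t'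
  end.

Definition popp : seq int -> seq int := map intZmod.oppz.

(** The inner match stops the shift at the last coefficient, so that a constant times the empty list
    stays empty. *)
Fixpoint pmul (s t : seq int) : seq int :=
  if s is a :: s' then
    padd (map (intRing.mulz a) t) (if s' is [::] then [::] else Posz 0 :: pmul s' t)
  else [::].

Definition pexp (s : seq int) n := iter n (pmul s) [:: Posz 1].

(** The operations do not normalize, so lists are compared up to trailing zeros. *)
Fixpoint peq (s t : seq int) : bool :=
  match s, t with
  | [::], _ => all (pred1 (Posz 0)) t
  | _, [::] => all (pred1 (Posz 0)) s
  | a :: s', b :: t' => (a == b) && peq s' t'
  end.

Lemma Poly_cons (a : int) s : Poly (a :: s) = Poly s * 'X + a%:P.
Proof. by rewrite /= cons_poly_def. Qed.

Lemma Poly_nil : Poly [::] = 0 :> {poly int}.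
Proof. by []. Qed.

Lemma Poly_padd s t : Poly (padd s t) = Poly s + Poly t.
Proof.
elim: s t => [|a s IHs] [|b t]; rewrite ?Poly_nil ?add0r ?addr0 //.
rewrite [padd _ _]/= !Poly_cons IHs polyCD mulrDl !addrA.
by rewrite (addrAC (Poly s * 'X)).
Qed.

Lemma Poly_scale a s : Poly (map (intRing.mulz a) s) = a%:P * Poly s.
Proof.
elim: s => [|b s IHs]; first by rewrite Poly_nil mulr0.
by rewrite [map _ _]/= !Poly_cons IHs mulrDr mulrA -polyCM.
Qed.

Lemma Poly_popp s : Poly (popp s) = - Poly s.
Proof.
elim: s => [|b s IHs]; first by rewrite Poly_nil oppr0.
by rewrite [popp _]/= !Poly_cons IHs opprD mulNr -polyCN.
Qed.

Lemma Poly_pmul s t : Poly (pmul s t) = Poly s * Poly t.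
Proof.
elim: s => [|a s IHs]; first by rewrite Poly_nil mul0r.
rewrite Poly_cons [pmul _ _]/= Poly_padd Poly_scale mulrDl addrC; congr (_ + _).
case: s IHs => [|b s] IHs; first by rewrite Poly_nil !mul0r.
by rewrite Poly_cons IHs addr0 -!mulrA (mulrC 'X).
Qed.

Lemma Poly_pexp s n : Poly (pexp s n) = Poly s ^+ n.
Proof.
elim: n => [|n IHn]; first by rewrite expr0 Poly_cons Poly_nil mul0r add0r.
by rewrite exprS -IHn -Poly_pmul.
Qed.

Lemma Poly_all0 s : all (pred1 (Posz 0)) s -> Poly s = 0 :> {poly int}.
Proof.
by elim: s => // a s IHs /andP[/eqP-> /IHs]; rewrite Poly_cons => ->; rewrite mul0r add0r.
Qed.

Lemma Poly_peq s t : peq s t -> Poly s = Poly t.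
Proof.
elim: s t => [|a s IHs] [|b t] //.
- by rewrite /peq => /Poly_all0 ->.
- by rewrite /peq => /Poly_all0 ->.
by case/andP=> /eqP-> /IHs; rewrite !Poly_cons => ->.
Qed.

Local Notation P := {poly int}.

(* Instance resolution on the syntax of a (block) matrix computes a function from
   natural indices to coefficient lists; it is [Defined], to be run. *)
Class poly_code (p : {poly int}) :=
  { pcode : seq int; pcodeE : p = Poly pcode }.
Arguments pcode p {_}.

Class mx_code m n (M : 'M[P]_(m, n)) :=
  { mcode : nat -> nat -> seq int;
    mcodeE : forall i j, M i j = Poly (mcode i j) }.
Arguments mcode {m n} M {_}.

#[local] Instance poly_code1 : poly_code 1.
Proof. by exists [:: Posz 1]; rewrite Poly_cons Poly_nil mul0r add0r. Defined.

#[local] Instance poly_codeX : poly_code 'X.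
Proof.
by exists [:: Posz 0; Posz 1]; rewrite !Poly_cons Poly_nil mul0r add0r addr0 mul1r.
Defined.

#[local] Instance poly_codeD p p'
  {c1 : poly_code p} {c2 : poly_code p'} : poly_code (p + p').
Proof. by exists (padd (pcode p) (pcode p')); rewrite Poly_padd -!pcodeE. Defined.

#[local] Instance poly_codeN p {c1 : poly_code p} : poly_code (- p).
Proof. by exists (popp (pcode p)); rewrite Poly_popp -!pcodeE. Defined.

#[local] Instance poly_codeM p p'
  {c1 : poly_code p} {c2 : poly_code p'} : poly_code (p * p').
Proof. by exists (pmul (pcode p) (pcode p')); rewrite Poly_pmul -!pcodeE. Defined.

#[local] Instance poly_code_exp p n {c1 : poly_code p} : poly_code (p ^+ n).
Proof. by exists (pexp (pcode p) n); rewrite Poly_pexp -!pcodeE. Defined.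

#[local] Instance mx_code0 m n : mx_code (0 : 'M[P]_(m, n)).
Proof. by exists (fun _ _ => [::]) => i j; rewrite mxE. Defined.

#[local] Instance mx_code_const m n p {c1 : poly_code p} :
  mx_code (const_mx p : 'M[P]_(m, n)).
Proof. by exists (fun _ _ => pcode p) => i j; rewrite mxE -pcodeE. Defined.

#[local] Instance mx_code_id n : mx_code (1%:M : 'M[P]_n).
Proof.
exists (fun i j => if i == j then pcode 1 else [::]) => i j.
by rewrite mxE -val_eqE; case: eqP => _; rewrite ?mulr0n // mulr1n -pcodeE.
Defined.

#[local] Instance mx_codeD m n (A B : 'M[P]_(m, n))
  {c1 : mx_code A} {c2 : mx_code B} : mx_code (A + B).
Proof.
by exists (fun i j => padd (mcode A i j) (mcode B i j)) => i j;
  rewrite mxE Poly_padd -!mcodeE.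
Defined.

#[local] Instance mx_codeN m n (A : 'M[P]_(m, n)) {c1 : mx_code A} : mx_code (- A).
Proof.
by exists (fun i j => popp (mcode A i j)) => i j; rewrite mxE Poly_popp -!mcodeE.
Defined.

#[local] Instance mx_codeZ m n p (A : 'M[P]_(m, n))
  {c1 : poly_code p} {c2 : mx_code A} : mx_code (p *: A).
Proof.
(* A zero entry must stay the empty list, the only form of zero that [row_mul] skips. *)
exists (fun i j =>
  if mcode A i j is [::] then [::] else pmul (pcode p) (mcode A i j)) => i j.
rewrite mxE mcodeE; case: mcode => [|a s]; first by rewrite mulr0.
by rewrite Poly_pmul -pcodeE.
Defined.

#[local] Instance mx_codeT m n (A : 'M[P]_(m, n)) {c1 : mx_code A} : mx_code A^T.
Proof. by exists (fun i j => mcode A j i) => i j; rewrite mxE -!mcodeE. Defined.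

#[local] Instance mx_code_row m n1 n2 (A : 'M[P]_(m, n1)) (B : 'M[P]_(m, n2))
  {c1 : mx_code A} {c2 : mx_code B} : mx_code (row_mx A B).
Proof.
exists (fun i j => if (j < n1)%N then mcode A i j else mcode B i (j - n1)) => i j.
by rewrite mxE; case: split_ordP => k ->; rewrite mcodeE /= ?ltn_ord // addKn.
Defined.

#[local] Instance mx_code_col m1 m2 n (A : 'M[P]_(m1, n)) (B : 'M[P]_(m2, n))
  {c1 : mx_code A} {c2 : mx_code B} : mx_code (col_mx A B).
Proof.
exists (fun i j => if (i < m1)%N then mcode A i j else mcode B (i - m1) j) => i j.
by rewrite mxE; case: split_ordP => k ->; rewrite mcodeE /= ?ltn_ord // addKn.
Defined.

#[local] Instance mx_code_diag n (d : 'rV[P]_n) {c1 : mx_code d} : mx_code (diag_mx d).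
Proof.
exists (fun i j => if i == j then mcode d 0 j else [::]) => i j.
rewrite mxE -val_eqE; case: (eqVneq i j) => [->|/negPf ne].
  by rewrite eqxx mulr1n mcodeE.
by rewrite val_eqE ne mulr0n.
Defined.

(** [octa_J] is a cyclic shift, so its powers get a closed form and need no matrix product when
    run. *)
Lemma octa_J_exp k i j :
  (octa_J ^+ k) i j = ((j : nat) == ((i + k) %% 6)%N)%:R.
Proof.
elim: k i j => [|k IHk] i j.
  by rewrite expr0 addn0 modn_small // mxE -val_eqE eq_sym.
(* The only nonzero entry of row [i] of [octa_J] lies in column [l]. *)
pose l : 'I_6 := Ordinal (ltn_pmod i.+1 (isT : 0 < 6)%N).
rewrite exprS mxE (bigD1 l) //= big1 ?addr0 => [|h ne].
  by rewrite mxE eqxx mul1r IHk /= modnDml addSnnS.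
by rewrite mxE -(inj_eq val_inj) in ne *; rewrite (negPf ne) mul0r.
Qed.

#[local] Instance mx_code_J_exp k : mx_code (octa_J ^+ k).
Proof.
exists (fun i j => if j == ((i + k) %% 6)%N then pcode 1 else [::]) => i j.
by rewrite octa_J_exp; case: eqP => _; rewrite -?pcodeE.
Defined.

#[local] Instance mx_code_J : mx_code octa_J.
Proof. by exists (mcode (octa_J ^+ 1)) => i j; rewrite -mcodeE expr1. Defined.

Local Notation bU := (1 + (6 + (2 + (6 + (6 + (6 + (6 + (6 + (6 + (6 + (2 +
  6)))))))))))%N.
Local Notation bLR := (33 + (6 + (6 + (6 + (2 + 6)))))%N.
Local Notation bD := (1 + (8 + (24 + (20 + 6))))%N.

(* [refine] restores the block sizes, which are only convertible to the declared
   dimensions. The 59 x 59 codes are not instances, because resolution would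
   try to unify the unfolded bodies of these matrices with one another. *)
#[local] Instance mx_code_octa_I2 : mx_code octa_I2.
Proof. rewrite /octa_I2; refine (_ : @mx_code 2 (2 + (2 + 2))%N _); exact _. Defined.

Definition octa_U_code : mx_code octa_U.
Proof. rewrite /octa_U; refine (_ : @mx_code bU bU _); exact _. Defined.

Definition octa_L_code : mx_code octa_L.
Proof. rewrite /octa_L; refine (_ : @mx_code bLR bLR _); exact _. Defined.

Definition octa_R_code : mx_code octa_R.
Proof. rewrite /octa_R; refine (_ : @mx_code bLR bLR _); exact _. Defined.

Definition octa_D_code : mx_code octa_D.
Proof. rewrite /octa_D; refine (_ : @mx_code bD bD _); exact _. Defined.

(** * Matrix products on tables of coefficient lists *)

Definition tabulates m n (M : 'M[P]_(m, n)) (T : seq (seq (seq int))) :=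
  size T = m /\ forall i j, M i j = Poly (nth [::] (nth [::] T i) j).

Definition table m n (f : nat -> nat -> seq int) :=
  mkseq (fun i => mkseq (f i) n) m.

Lemma table_tabulates m n (M : 'M[P]_(m, n)) (f : nat -> nat -> seq int) :
  (forall i j, M i j = Poly (f i j)) -> tabulates M (table m n f).
Proof. by move=> Mf; split=> [|i j]; rewrite ?size_mkseq // !nth_mkseq. Qed.

Definition transpose_table m n (T : seq (seq (seq int))) :=
  table n m (fun j i => nth [::] (nth [::] T i) j).

Lemma transpose_tabulates m n (M : 'M[P]_(m, n)) T :
  tabulates M T -> tabulates M^T (transpose_table m n T).
Proof. by case=> _ MT; apply: table_tabulates => i j; rewrite mxE. Qed.

Fixpoint row_add (r s : seq (seq int)) :=
  match r, s with
  | [::], _ => s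
  | _, [::] => r
  | a :: r', b :: s' => padd a b :: row_add r' s'
  end.

(** The product is a linear combination of the rows of [T]; zero coefficients are skipped, so a
    sparse left factor makes it cheap. *)
Fixpoint row_mul (r : seq (seq int)) (T : seq (seq (seq int))) :=
  match r, T with
  | a :: r', s :: T' =>
      if a is [::] then row_mul r' T' else row_add (map (pmul a) s) (row_mul r' T')
  | _, _ => [::]
  end.

Definition mul_table S T := map (row_mul^~ T) S.

Lemma Poly_row_add r s j :
  Poly (nth [::] (row_add r s) j) = Poly (nth [::] r j) + Poly (nth [::] s j).
Proof.
elim: r s j => [|a r IHr] [|b s] [|j]; rewrite ?Poly_nil ?add0r ?addr0 //.
- exact: Poly_padd.
- exact: IHr.
Qed.

Lemma Poly_row_mul n r T j : size T = n ->
  Poly (nth [::] (row_mul r T) j) =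
  \sum_(k < n) Poly (nth [::] r k) * Poly (nth [::] (nth [::] T k) j).
Proof.
elim: n r T => [|n IHn] [|a r] [|s T] // => [_|_|_|[szT]];
  rewrite ?big_ord0 ?nth_nil ?Poly_nil //.
  by rewrite big1 // => k _; rewrite nth_nil mul0r.
rewrite big_ord_recl -IHn //=.
case: a => [|a a']; first by rewrite Poly_nil mul0r add0r.
rewrite Poly_row_add; congr (_ + _).
case: (ltnP j (size s)) => [lt_js|le_sj]; first by rewrite (nth_map [::]) // Poly_pmul.
by rewrite !nth_default ?size_map // Poly_nil mulr0.
Qed.

Lemma mul_tabulates m n p (A : 'M[P]_(m, n)) (B : 'M[P]_(n, p)) S T :
  tabulates A S -> tabulates B T -> tabulates (A *m B) (mul_table S T).
Proof.
case=> szS AS [szT BT]; split=> [|i j]; first by rewrite size_map.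
rewrite (nth_map [::]) ?szS ?ltn_ord // (Poly_row_mul _ _ szT) mxE.
by apply: eq_bigr => k _; rewrite AS BT.
Qed.

Lemma ord_all n (p : nat -> bool) : all p (iota 0 n) -> forall i : 'I_n, p i.
Proof. by move=> /allP allP i; apply: allP; rewrite mem_iota /=. Qed.

Lemma ord_all2 m n (p : nat -> nat -> bool) :
  all (fun i => all (p i) (iota 0 n)) (iota 0 m) -> forall (i : 'I_m) (j : 'I_n), p i j.
Proof. by move=> allP2 i j; apply: ord_all (ord_all allP2 i) j. Qed.

Definition table_eq m n S T :=
  all (fun i => all (fun j => peq (nth [::] (nth [::] S i) j) (nth [::] (nth [::] T i) j))
                    (iota 0 n)) (iota 0 m).

Lemma table_eq_mx m n (A B : 'M[P]_(m, n)) S T :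
  tabulates A S -> tabulates B T -> table_eq m n S T -> A = B.
Proof.
move=> [_ AS] [_ BT] eqST; apply/matrixP => i j; rewrite AS BT.
by apply: Poly_peq; apply: (ord_all2 eqST).
Qed.

(** * The explicit Varchenko matrix and its Smith normal form *)

Definition octa_separation (i j : nat) : nat :=
  count (fun k => (k \in nth [::] octa_labels i) (+) (k \in nth [::] octa_labels j))
    (iota 1 8).

Definition octa_V : 'M[{poly int}]_59 := \matrix_(i, j) 'X^(octa_separation i j).

Definition octa_V_code : mx_code octa_V.
Proof.
exists (fun i j => ncons (octa_separation i j) (Posz 0) [:: Posz 1]) => i j.
rewrite mxE; elim: octa_separation => [|k IHk].
  by rewrite expr0 Poly_cons Poly_nil mul0r add0r.
by rewrite [ncons _ _ _]/= Poly_cons -IHk addr0 exprSr.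
Defined.

Lemma code_tabulates m n (M : 'M[P]_(m, n)) (c : mx_code M) :
  tabulates M (table m n (mcode M)).
Proof. exact/table_tabulates/mcodeE. Qed.

(** [octa_U] is lower triangular with ones on the diagonal, hence of determinant 1. *)
Lemma octa_U_unit : octa_U \in unitmx.
Proof.
pose c := octa_U_code.
(* One check covers the diagonal and the upper triangle; entries below the diagonal are compared
   with themselves. *)
have utri : all (fun i => all (fun j => peq (@mcode _ _ _ c i j)
    (if i == j then [:: Posz 1] else if (i < j)%N then [::] else @mcode _ _ _ c i j))
    (iota 0 59)) (iota 0 59) by vm_compute.
have {}utri (i j : 'I_59) := Poly_peq (ord_all2 utri i j).
have trigU : is_trig_mx octa_U.
  apply/is_trig_mxP => i j lt_ij.
  by rewrite (@mcodeE _ _ _ c) utri ltn_eqF // lt_ij.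
rewrite unitmxE (det_trig trigU) big1 ?unitr1 // => i _.
by rewrite (@mcodeE _ _ _ c) utri eqxx -(@pcodeE _ poly_code1).
Qed.

(* Obtained by inverting the 3 x 3 block matrices by which [octa_L] and [octa_R]
   act on the index blocks 2, 3 and 6; both have determinant 1. *)
Section TransitionInverses.
Local Notation q := ('X : {poly int}).
Local Notation I := (1%:M : 'M[{poly int}]_6).

Definition octa_L_inv : 'M[{poly int}]_59 :=
  ([colb
  [rowb 1%:M, 0, 0, 0, 0 & 0],
  [rowb 0, (1 + q ^+ 2) *: I, - (q ^+ 2 + q ^+ 4 + q ^+ 6) *: I, 0, 0 & q *: I],
  [rowb 0, 0, I, 0, 0 & 0],
  [rowb 0, 0, 0, I, 0 & 0],
  [rowb 0, 0, 0, 0, 1%:M & 0] &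
  [rowb 0, q *: I, - (q ^+ 3 + q ^+ 5) *: I, 0, 0 & I]]
  : 'M[{poly int}]_(bLR, bLR)).

Definition octa_R_inv : 'M[{poly int}]_59 :=
  ([colb
  [rowb 1%:M, 0, 0, 0, 0 & 0],
  [rowb 0, I, q ^+ 4 *: I, 0, 0 & 0],
  [rowb 0, 0, (1 + q ^+ 2) *: I, 0, 0 & q *: I],
  [rowb 0, 0, 0, I, 0 & 0],
  [rowb 0, 0, 0, 0, 1%:M & 0] &
  [rowb 0, 0, q *: I, 0, 0 & I]]
  : 'M[{poly int}]_(bLR, bLR)).
End TransitionInverses.

Definition octa_L_inv_code : mx_code octa_L_inv.
Proof. rewrite /octa_L_inv; refine (_ : @mx_code bLR bLR _); exact _. Defined.

Definition octa_R_inv_code : mx_code octa_R_inv.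
Proof. rewrite /octa_R_inv; refine (_ : @mx_code bLR bLR _); exact _. Defined.

Lemma octa_L_unit : octa_L \in unitmx.
Proof.
have LK : octa_L *m octa_L_inv = 1%:M.
  apply: table_eq_mx (mul_tabulates (code_tabulates octa_L_code)
    (code_tabulates octa_L_inv_code)) (code_tabulates (mx_code_id 59)) _.
  by vm_compute.
exact: (mulmx1_unit LK).1.
Qed.

Lemma octa_R_unit : octa_R \in unitmx.
Proof.
have RK : octa_R *m octa_R_inv = 1%:M.
  apply: table_eq_mx (mul_tabulates (code_tabulates octa_R_code)
    (code_tabulates octa_R_inv_code)) (code_tabulates (mx_code_id 59)) _.
  by vm_compute.
exact: (mulmx1_unit RK).1.
Qed.

(* On the right-hand side the left factor of every product is one of the
   sparse matrices L, U, Q^T. *)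
Lemma mulmx_left_bracketing (S : comNzRingType) n (L U V Q : 'M[S]_n) :
  (L *m U) *m V *m (U^T *m Q) = (Q^T *m (U *m (L *m (U *m V))^T))^T.
Proof. by rewrite !trmx_mul !trmxK !mulmxA. Qed.

Lemma octa_factorization :
  octa_D = (octa_L *m octa_U) *m octa_V *m (octa_U^T *m octa_R).
Proof.
have tabU := code_tabulates octa_U_code.
(* [tabP] tabulates $LUV$, and [tabQ] tabulates $R^t(U(LUV)^t)$, the transpose of the full
   product. *)
have tabP := mul_tabulates (code_tabulates octa_L_code)
  (mul_tabulates tabU (code_tabulates octa_V_code)).
have tabQ := mul_tabulates (transpose_tabulates (code_tabulates octa_R_code))
  (mul_tabulates tabU (transpose_tabulates tabP)).
rewrite mulmx_left_bracketing.
apply: table_eq_mx (code_tabulates octa_D_code) (transpose_tabulates tabQ) _.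
by vm_compute.
Qed.

(** Quotients of consecutive diagonal entries. They differ from 1 only at the last index of a block;
    the last one is $(1-q^8)/(1-q^2)$. *)
Definition octa_D_quotient (i : nat) : seq int :=
  if i \in [:: 0; 8; 32]%N then pcode (1 - 'X^2)
  else if i == 52 then pcode (1 + 'X^2 + 'X^4 + 'X^6) else pcode 1.

Lemma octa_D_dvd (i j : 'I_59) : j = i.+1 :> nat -> ring_dvd (octa_D i i) (octa_D j j).
Proof.
pose c := octa_D_code.
have quoP : all (fun i => all (fun j => (j == i.+1) ==>
    peq (@mcode _ _ _ c j j) (pmul (octa_D_quotient i) (@mcode _ _ _ c i i)))
    (iota 0 59)) (iota 0 59) by vm_compute.
move=> ji; exists (Poly (octa_D_quotient i)).
rewrite !(@mcodeE _ _ _ c) -Poly_pmul; apply: Poly_peq.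
by have /implyP := ord_all2 quoP i j; apply; apply/eqP.
Qed.

Lemma octa_smith_normal_form :
  smith_normal_form octa_V octa_D (octa_L *m octa_U) (octa_U^T *m octa_R).
Proof.
split.
- exact: diag_mx_is_diag.
- exact: octa_D_dvd.
- by rewrite unitmx_mul octa_L_unit octa_U_unit.
- by rewrite unitmx_mul unitmx_tr octa_U_unit octa_R_unit.
- exact: octa_factorization.
Qed.

(** * Regions as sign cells *)

Section ArrangementCells.
Variables (R : realType) (n : nat) (I : finType) (A : I -> 'rV[R]_n * R).

Lemma lin_form_continuous (a : 'rV[R]_n) : continuous (lin_form a).
Proof.
apply: (@continuous_big R 'I_n +%R 0 predT (@add_continuous R) 'rV[R]_n
  (index_enum _) (fun j x => a 0 j * x 0 j)) => j _ x.
by apply: (@continuousM R _ (fun=> a 0 j));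
  [exact: cst_continuous|exact: coord_continuous].
Qed.

Lemma lin_form_segment (a x y : 'rV[R]_n) t :
  lin_form a (x + t *: (y - x)) = (1 - t) * lin_form a x + t * lin_form a y.
Proof.
rewrite /lin_form !mulr_sumr -big_split; apply: eq_bigr => j _ /=.
by rewrite !mxE; ring.
Qed.

Definition cell (s : {set I}) : set 'rV[R]_n :=
  [set x | forall k, if k \in s then above (A k) x else below (A k) x].

Lemma cell_sub_complement s : cell s `<=` arr_complement A.
Proof.
move=> x sx [k _]; rewrite /hyperplane /= => xk; have := sx k.
by case: ifP => _; rewrite /above /below /= xk ltxx.
Qed.

Lemma complement_cell x :
  arr_complement A x -> cell [set k | (A k).2 < lin_form (A k).1 x]%SET x.
Proof.
move=> Ax k; rewrite inE; case: ifP => // /negbT; rewrite -leNgt le_eqVlt.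
by case/orP => // /eqP xk; case: Ax; exists k.
Qed.

Lemma cell_convex s x y t : cell s x -> cell s y -> 0 <= t <= 1 ->
  cell s (x + t *: (y - x)).
Proof.
have mix (c u v : R) : 0 <= t <= 1 -> c < u -> c < v -> c < (1 - t) * u + t * v.
  move=> /andP[]; rewrite le_eqVlt => /predU1P[<- _ cu _|t0 t1].
    by rewrite subr0 mul1r mul0r addr0.
  rewrite -(subr_gt0 c u) -(subr_gt0 c v) -(subr_gt0 c (_ + _)) => u0 v0.
  rewrite (_ : _ - c = (1 - t) * (u - c) + t * (v - c)); last by ring.
  apply: ltr_wpDl; last exact: mulr_gt0.
  by apply: mulr_ge0; [rewrite subr_ge0|exact: ltW].
move=> sx sy t01 k; move: (sx k) (sy k).
case: ifP => _; rewrite /above /below /= lin_form_segment; first exact: mix.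
move=> u0 v0; rewrite -ltrN2 opprD -!mulrN; apply: mix => //; by rewrite ltrN2.
Qed.

(** By convexity a nonempty cell is a union of segments issued from one of its points. *)
Lemma cell_connected s : connected (cell s).
Proof.
have [->|/set0P[x sx]] := eqVneq (cell s) set0; first exact: connected0.
pose seg y := (fun t : R => x + t *: (y - x)) @` `[0, 1].
have cellE : cell s = \bigcup_(y in cell s) seg y.
  apply/seteqP; split=> [y sy|z [y sy [t]]].
    exists y => //; exists 1; rewrite /= ?in_itv /= ?ler01 ?lexx //.
    by rewrite scale1r addrC subrK.
  by rewrite /= in_itv /= => t01 <-; apply: cell_convex.
rewrite cellE; apply: bigcup_connected.
  exists x => y sy; exists 0; rewrite /= ?in_itv /= ?ler01 ?lexx //.
  by rewrite scale0r addr0.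
move=> y _; apply: connected_continuous_connected; first exact: segment_connected.
apply: continuous_subspaceT => t; apply: cvgD; first exact: cvg_cst.
exact: scalel_continuous.
Qed.

(** Each form maps [C] onto an interval that misses the level of its hyperplane, so all of [C] lies
    on the side of [x]. *)
Lemma connected_sub_cell (C : set 'rV[R]_n) s x :
  connected C -> C `<=` arr_complement A -> C x -> cell s x -> C `<=` cell s.
Proof.
move=> cC subC Cx sx y Cy k.
have /connected_intervalP itvC : connected (lin_form (A k).1 @` C).
  apply: connected_continuous_connected => //; apply: continuous_subspaceT.
  exact: lin_form_continuous.
have avoid z : C z -> lin_form (A k).1 z <> (A k).2.
  by move=> /subC Az zk; apply: Az; exists k.
have imC z : C z -> (lin_form (A k).1 @` C) (lin_form (A k).1 z) by exists z.
have := sx k; case: ifP => _; rewrite /above /below /= => xk.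
  rewrite ltNge; apply/negP => yk.
  have [|z Cz] := itvC _ _ (imC _ Cy) (imC _ Cx) (A k).2; first by rewrite yk ltW.
  exact: avoid.
rewrite ltNge; apply/negP => yk.
have [|z Cz] := itvC _ _ (imC _ Cx) (imC _ Cy) (A k).2; first by rewrite yk ltW.
exact: avoid.
Qed.

Lemma component_cell s x :
  cell s x -> connected_component (arr_complement A) x = cell s.
Proof.
move=> sx; have Ax := cell_sub_complement sx; apply/seteqP; split.
  apply: connected_sub_cell sx; first exact: component_connected.
    exact: connected_component_sub.
  exact: connected_component_refl.
apply: connected_component_max => //; first exact: cell_sub_complement.
exact: cell_connected.
Qed.

Lemma regionP (C : set 'rV[R]_n) :
  regions A C <-> exists2 s, cell s !=set0 & C = cell s.
Proof.
split=> [[x Ax <-]|[s [x sx] ->]].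
  by have sx := complement_cell Ax; eexists; [exists x; exact: sx|exact: component_cell].
by exists x; [exact: cell_sub_complement sx|exact: component_cell].
Qed.

(** Inclusion in cells is enough, so this applies to [octa_center] before it is known to be a cell.
    Nonemptiness rules out vacuous separation. *)
Lemma sep_sub_cell (C D : set 'rV[R]_n) s t :
  C !=set0 -> D !=set0 -> C `<=` cell s -> D `<=` cell t ->
  sep A C D = [set k | (k \in s) (+) (k \in t)]%SET.
Proof.
move=> [x Cx] [y Dy] Cs Dt; apply/setP => k; rewrite !inE.
apply/asboolP/idP.
  case=> -[/(_ _ Cx) xk /(_ _ Dy) yk]; move: (Cs _ Cx k) (Dt _ Dy k) xk yk;
    by do 2!case: ifP => _; rewrite /above /below /=; lra.
have Ck z (Cz : C z) := Cs z Cz k; have Dk z (Dz : D z) := Dt z Dz k.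
by move: Ck Dk; case: (k \in s); case: (k \in t) => //= Ck Dk _; [right|left].
Qed.

End ArrangementCells.

(** * The octahedral arrangement *)

(* Twice the coordinates of a point in each region. *)
Definition octa_witnesses : seq (seq int) :=
  [:: [:: 0; 0; 0]; [:: 1; 1; 1]; [:: -1; 1; 1]; [:: -1; -1; 1];
   [:: -1; -1; -1]; [:: 1; -1; -1]; [:: 1; 1; -1]; [:: 1; -1; 1];
   [:: -1; 1; -1]; [:: 1; 2; 0]; [:: 0; 1; 2]; [:: -2; 0; 1]; [:: -2; -1; 0];
   [:: 0; -2; -1]; [:: 1; 0; -2]; [:: 1; 0; 2]; [:: -2; 1; 0]; [:: 0; -2; 1];
   [:: -2; 0; -1]; [:: 1; -2; 0]; [:: 0; 1; -2]; [:: 3; 1; 1]; [:: -1; 3; 1];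
   [:: -1; -1; 3]; [:: -3; -1; -1]; [:: 1; -3; -1]; [:: 1; 1; -3];
   [:: 3; -1; 1]; [:: -1; 3; -1]; [:: 1; -1; 3]; [:: -3; 1; -1];
   [:: 1; -3; 1]; [:: -1; 1; -3]; [:: 3; -1; -1]; [:: 1; 3; -1];
   [:: 1; 1; 3]; [:: -3; 1; 1]; [:: -1; -3; 1]; [:: -1; -1; -3];
   [:: 3; 1; -1]; [:: 1; 3; 1]; [:: -1; 1; 3]; [:: -3; -1; 1];
   [:: -1; -3; -1]; [:: 1; -1; -3]; [:: 3; 3; 3]; [:: -3; 3; 3];
   [:: -3; -3; 3]; [:: -3; -3; -3]; [:: 3; -3; -3]; [:: 3; 3; -3];
   [:: 3; -3; 3]; [:: -3; 3; -3]; [:: 3; 0; 0]; [:: 0; 3; 0]; [:: 0; 0; 3];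
   [:: -3; 0; 0]; [:: 0; -3; 0]; [:: 0; 0; -3]]%Z.

(* Farkas certificates: weights [w_k] on the eight forms [l_k - 1] whose linear
   parts cancel, with [\sum_k w_k >= 0]. No point has [l_k > 1] wherever
   [w_k > 0] and [l_k < 1] wherever [w_k < 0]. *)
Definition octa_infeasibility : seq (seq int) :=
  [:: [:: 0; 0; 0; 0; 0; 0; 1; 1]; [:: 0; 0; 1; 0; 0; 1; 0; 0];
   [:: 0; 1; 0; 0; 1; 0; 0; 0]; [:: 1; 0; 0; 1; 0; 0; 0; 0];
   [:: -1; 0; 0; 0; -1; 1; 1; 0]; [:: -1; 1; -1; 0; 0; 0; 1; 0];
   [:: -1; 1; 0; 0; 0; 1; 0; -1]; [:: -1; 1; 0; 0; 0; 1; 1; 0];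
   [:: 0; -1; 1; -1; 0; 0; 0; 1]; [:: 0; 0; -1; 1; -1; 0; 1; 0];
   [:: 0; 0; 0; -1; 1; -1; 0; 1]; [:: 0; 0; 0; 1; -1; 1; 0; -1];
   [:: 0; 0; 0; 1; -1; 1; 1; 0]; [:: 0; 0; 1; -1; 1; 0; -1; 0];
   [:: 0; 0; 1; -1; 1; 0; 0; 1]; [:: 0; 1; -1; 1; 0; 0; 0; -1];
   [:: 0; 1; -1; 1; 0; 0; 1; 0]; [:: 0; 1; 0; 1; 0; 1; 0; -1];
   [:: 0; 1; 0; 1; 0; 1; 1; 0]; [:: 1; -1; 0; 0; 0; -1; 0; 1];
   [:: 1; -1; 1; 0; 0; 0; -1; 0]; [:: 1; -1; 1; 0; 0; 0; 0; 1];
   [:: 1; 0; 0; 0; 1; -1; -1; 0]; [:: 1; 0; 0; 0; 1; -1; 0; 1];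
   [:: 1; 0; 1; 0; 1; 0; -1; 0]; [:: 1; 0; 1; 0; 1; 0; 0; 1]]%Z.

Definition octa_sign (k j : nat) : int := (nth [::] octa_signs k)`_j.

Definition octa_label_set (i : nat) : {set 'I_8} :=
  [set k : 'I_8 | k.+1 \in nth [::] octa_labels i]%SET.

(** A form of the sum that [vm_compute] can evaluate. *)
Definition isum n (F : nat -> int) : int := foldr (fun k s => F k + s) 0 (iota 0 n).

Lemma isumE n (F : nat -> int) : isum n F = \sum_(k < n) F k.
Proof.
rewrite -(big_mkord xpredT) /index_iota subn0 /isum.
by elim: (iota 0 n) => [|k s IHs]; rewrite ?big_nil // big_cons -IHs.
Qed.

(** The level is 2 instead of 1 because the coordinates of the witnesses are doubled. *)
Lemma octa_witnessP : all (fun i => all (fun k =>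
    let v := isum 3 (fun j => octa_sign k j * (nth [::] octa_witnesses i)`_j) in
    if k.+1 \in nth [::] octa_labels i then 2 < v else v < 2) (iota 0 8)) (iota 0 59).
Proof. by vm_compute. Qed.

Fixpoint forall_bits n (P : seq bool -> bool) : bool :=
  if n is n'.+1 then
    forall_bits n' (fun b => P (true :: b)) && forall_bits n' (fun b => P (false :: b))
  else P [::].

Lemma forall_bitsP n P b : forall_bits n P -> size b = n -> P b.
Proof.
elim: n P b => [|n IHn] P [|c b] //= /andP[Pt Pf] [szb].
by case: c; [apply: (IHn (fun b => P (true :: b)))|
  apply: (IHn (fun b => P (false :: b)))].
Qed.

Definition refutes (w : seq int) (b : seq bool) : bool :=
  all (fun k => ((0 < w`_k) ==> nth false b k) && ((w`_k < 0) ==> ~~ nth false b k))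
    (iota 0 8).

(** Exhausting the 256 sign vectors shows that the list of labels is complete. *)
Lemma octa_bits_cover :
  forall_bits 8 (fun b =>
    has (fun i => all (fun k => nth false b k == (k.+1 \in nth [::] octa_labels i))
      (iota 0 8)) (iota 0 59)
    || has (refutes^~ b) octa_infeasibility).
Proof. by vm_compute. Qed.

Lemma octa_infeasibilityP : all (fun w =>
  [&& 0 <= isum 8 (fun k => w`_k), has (fun k => w`_k != 0) (iota 0 8) &
    all (fun j => isum 8 (fun k => w`_k * octa_sign k j) == 0) (iota 0 3)])
  octa_infeasibility.
Proof. by vm_compute. Qed.

Lemma octa_sign_norm :
  all (fun k => all (fun j => `|octa_sign k j| <= 1) (iota 0 3)) (iota 0 8).
Proof. by vm_compute. Qed.

(** * Identification of the regions and of their separating sets *)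

Section OctaGeometry.
Variable R : realType.
Local Notation planes := (@octa_planes R).

Lemma octa_formE (k : 'I_8) (x : 'rV[R]_3) :
  lin_form (planes k).1 x = \sum_(j < 3) (octa_sign k j)%:~R * x 0 j.
Proof. by apply: eq_bigr => j _; rewrite mxE. Qed.

Lemma octa_cell_neq0 (i : 'I_59) : cell planes (octa_label_set i) !=set0.
Proof.
pose z (j : nat) := (nth [::] octa_witnesses i)`_j.
exists (\row_j ((z j)%:~R / 2)) => k.
have := ord_all2 octa_witnessP i k; rewrite -/(z _) /= => hk.
have formE : lin_form (planes k).1 (\row_j ((z j)%:~R / 2)) =
    (isum 3 (fun j => octa_sign k j * z j))%:~R / 2.
  rewrite octa_formE isumE rmorph_sum mulr_suml; apply: eq_bigr => j _ /=.
  by rewrite mxE mulrA rmorphM.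
move: hk; rewrite inE; case: ifP => _; rewrite /above /below /= formE -(ltr_int R).
  by rewrite ltr_pdivlMr // mul1r.
by rewrite ltr_pdivrMr // mul1r.
Qed.

(** On the cell every term $w_k(l_k(x)-1)$ is nonnegative, and positive if $w_k\ne0$, which happens
    for some $k$. But the linear parts cancel, so the sum is $-\sum_k w_k\le0$. *)
Lemma octa_refuted (w : seq int) (b : seq bool) (s : {set 'I_8}) (x : 'rV[R]_3) :
  w \in octa_infeasibility -> (forall k : 'I_8, nth false b k = (k \in s)) ->
  refutes w b -> ~ cell planes s x.
Proof.
move=> /(allP octa_infeasibilityP)/and3P[w_ge0 /hasP[k0]].
rewrite mem_iota => /andP[_ lt_k08] wk0 w_rel0 bs wb0 sx.
have w_rel (j : 'I_3) := ord_all w_rel0 j.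
have wb (k : 'I_8) := ord_all (wb0 : all _ (iota 0 8)) k.
pose f (k : 'I_8) := (w`_k)%:~R * (lin_form (planes k).1 x - 1) : R.
have f_gt0 (k : 'I_8) : w`_k != 0 -> 0 < f k.
  move: (wb k) (sx k); rewrite bs /f.
  case: (ltrgt0P w`_k) => //= wk; case: (k \in s) => //= _;
    rewrite /above /below /= => xk _.
    by rewrite mulr_gt0 ?ltr0z // subr_gt0.
  by rewrite nmulr_lgt0 ?subr_lt0 // ltrz0.
have f_ge0 (k : 'I_8) : 0 <= f k.
  by have [w0|/f_gt0/ltW//] := eqVneq w`_k 0; rewrite /f w0 mul0r.
suff : \sum_(k < 8) f k <= 0.
  rewrite (bigD1 (Ordinal lt_k08)) //=; apply/negP; rewrite -ltNge.
  by rewrite ltr_pwDl ?f_gt0 // sumr_ge0.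
have -> : \sum_(k < 8) f k = - (isum 8 (fun k => w`_k))%:~R.
  rewrite isumE rmorph_sum /= -sumrN.
  under eq_bigr do rewrite /f mulrBr mulr1.
  rewrite sumrB -[RHS]add0r sumrN; congr (_ - _).
  (* The linear parts remain; after exchanging the sums, the coefficient of each coordinate is
     zero. *)
  under eq_bigr do rewrite octa_formE mulr_sumr.
  rewrite exchange_big big1 //= => j _.
  under eq_bigr do rewrite mulrA -rmorphM.
  rewrite -mulr_suml -rmorph_sum -(isumE 8 (fun k => w`_k * octa_sign k j)).
  by rewrite (eqP (w_rel j)) mul0r.
by rewrite oppr_le0 ler0z.
Qed.

Lemma octa_cell_label (s : {set 'I_8}) (x : 'rV[R]_3) :
  cell planes s x -> exists i : 'I_59, s = octa_label_set i.
Proof.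
move=> sx; pose b := [seq k \in s | k <- enum 'I_8].
have bs (k : 'I_8) : nth false b k = (k \in s).
  by rewrite (nth_map k) ?size_enum_ord // nth_ord_enum.
have szb : size b = 8 by rewrite size_map size_enum_ord.
case/orP: (forall_bitsP octa_bits_cover szb) => [|/hasP[w ow wb]].
  case/hasP => i; rewrite mem_iota => /andP[_ lt_i] ib0.
  have ib (k : 'I_8) := ord_all ib0 k.
  by exists (Ordinal lt_i); apply/setP => k; rewrite inE -(eqP (ib k)) bs.
by case: (octa_refuted ow bs wb sx).
Qed.

(** The coefficients have absolute value at most 1. Hence no form exceeds 1 on the octahedron. *)
Lemma octa_form_le (k : 'I_8) (x : 'rV[R]_3) :
  lin_form (planes k).1 x <= \sum_(j < 3) `|x 0 j|.
Proof.
rewrite octa_formE; apply: ler_sum => j _; apply: le_trans (ler_norm _) _.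
rewrite normrM ler_piMl // -intr_norm -[1]/(1%:~R) ler_int.
exact: (ord_all2 octa_sign_norm k j).
Qed.

(** The sum of absolute values is continuous and vanishes at the origin, so it stays below 1
    nearby. *)
Lemma octa_center0 : (@octa_center R) 0.
Proof.
have cont : continuous (fun x : 'rV[R]_3 => \sum_(j < 3) `|x 0 j|).
  apply: (@continuous_big R 'I_3 +%R 0 predT (@add_continuous R) 'rV[R]_3
    (index_enum _) (fun j x => `|x 0 j|)) => j _ x.
  by apply: (cvg_comp _ _ (@coord_continuous R 1 3 0 j x)); exact: norm_continuous.
have lt01 : \sum_(j < 3) `|(0 : 'rV[R]_3) 0 j| < 1.
  by rewrite big1 ?ltr01 // => j _; rewrite mxE normr0.
rewrite /octa_center /interior /=.
by apply: filterS (cvgr_lt _ (cont 0) _ lt01) => x /ltW.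
Qed.

Lemma octa_center_cell : @octa_center R `<=` cell planes finset.set0.
Proof.
move=> x xO k; rewrite inE /below /= ltNge; apply/negP => le1.
(* A point slightly further along the ray from the origin leaves the octahedron. *)
have dil : (fun t : R => t *: x) @ (1 : R) --> x.
  by rewrite -[X in _ --> X]scale1r; exact: scalel_continuous.
have /nbhs_ballP[e /= e0 eO] := dil _ xO.
have /eO/= tO : ball (1 : R) e (1 + e / 2).
  by rewrite /ball /= opprD addrA subrr add0r normrN gtr0_norm ?divr_gt0 //
    ltr_pdivrMr // mulr_natr mulr2n ltrDl.
(* At the dilated point the form is at least $1+e/2$, yet the octahedron bounds it by 1. *)
have := le_trans (octa_form_le k _) tO.
rewrite octa_formE; under eq_bigr do rewrite mxE mulrCA.
rewrite -mulr_sumr -octa_formE; apply/negP; rewrite -ltNge.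
apply: lt_le_trans (_ : 1 + e / 2 <= _); first by rewrite ltrDl divr_gt0.
by rewrite ler_peMr // addr_ge0 // divr_ge0 // ltW.
Qed.

Lemma octa_sep_center s : cell planes s !=set0 ->
  sep planes (@octa_center R) (cell planes s) = s.
Proof.
move=> s0; rewrite (sep_sub_cell _ s0 octa_center_cell (@subset_refl _ _)).
  by apply/setP => k; rewrite !inE.
by exists 0; exact: octa_center0.
Qed.

Lemma card_octa_sep (i j : nat) :
  #|[set k | (k \in octa_label_set i) (+) (k \in octa_label_set j)]%SET| =
  octa_separation i j.
Proof.
(* Labels run from 1 to 8 but ordinals from 0 to 7, hence the shift of [iota]. *)
rewrite -sum1dep_card /octa_separation -sum1_count (iotaDl 1 0 8) big_map.
rewrite -[iota 0 8]/(index_iota 0 8) big_mkord.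
by apply: eq_bigl => k; rewrite !inE add1n.
Qed.

(** Equal label sets have separation 0, which a finite check finds only on the diagonal. *)
Lemma octa_label_set_inj (i j : 'I_59) : octa_label_set i = octa_label_set j -> i = j.
Proof.
have sepP : all (fun i => all (fun j => (octa_separation i j == 0) ==> (i == j))
    (iota 0 59)) (iota 0 59).
  by vm_compute.
move=> ij; have /implyP := ord_all2 sepP i j; rewrite -card_octa_sep ij => H.
by apply/val_inj/eqP/H; rewrite cards_eq0; apply/eqP/setP => k; rewrite !inE addbb.
Qed.

(** A region is a cell, and its sign set is recovered as its separation from the center; the labels
    thus determine [reg]. *)
Lemma octa_ordering_cell (reg : 'I_59 -> set 'rV[R]_3) (i : 'I_59) :
  octa_ordering reg ->
  reg i = cell planes (octa_label_set i) /\ reg i !=set0.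
Proof.
move=> [[regions_reg _ _] /(_ i) sep_i].
have /regionP[s s0 regE] := regions_reg i I.
rewrite regE octa_sep_center // in sep_i.
by rewrite regE /octa_label_set -sep_i.
Qed.

(** Provides an ordering, so that the claim about all orderings is not vacuous. *)
Lemma octa_cell_ordering :
  octa_ordering (fun i : 'I_59 => cell planes (octa_label_set i)).
Proof.
split=> [|i]; last exact/octa_sep_center/octa_cell_neq0.
split=> [i _|i j _ _ ij|C /regionP[s [x sx] ->]].
- by apply/regionP; exists (octa_label_set i) => //; exact: octa_cell_neq0.
- apply: octa_label_set_inj.
  rewrite -(octa_sep_center (octa_cell_neq0 i)) /= ij octa_sep_center //.
  exact: octa_cell_neq0.
by have [i si] := octa_cell_label sx; exists i => //=; rewrite si.
Qed.

Lemma octa_varchenko_mx (reg : 'I_59 -> set 'rV[R]_3) :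
  octa_ordering reg -> varchenko_mx planes reg = octa_V.
Proof.
move=> reg_ord; apply/matrixP => i j; rewrite !mxE -card_octa_sep.
have [iE i0] := octa_ordering_cell i reg_ord.
have [jE j0] := octa_ordering_cell j reg_ord.
by rewrite (sep_sub_cell (s := octa_label_set i) (t := octa_label_set j)) // ?iE ?jE.
Qed.

End OctaGeometry.

Theorem mainTheorem8 (R : realType) :
  (exists reg : 'I_59 -> set 'rV[R]_3, octa_ordering reg) /\
  (forall reg : 'I_59 -> set 'rV[R]_3, octa_ordering reg ->
     smith_normal_form (varchenko_mx (@octa_planes R) reg) octa_D
       (octa_L *m octa_U) (octa_U^T *m octa_R)).
Proof.
split; first by eexists; exact: octa_cell_ordering.
by move=> reg /octa_varchenko_mx ->; exact: octa_smith_normal_form.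
Qed.
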